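(* Let $\alpha,\beta,\gamma,\delta,\phi,\kappa$ be real numbers with $0\le \alpha,\beta,\gamma,\delta,\phi,\kappa\le 1$, $\beta+\gamma\le 1$ and $\delta+\phi\le 1$, and let $$A=\begin{pmatrix}\alpha & 1-\alpha & 0 & 0\\ \beta & \gamma & 1-\beta-\gamma & 0\\ 0 & \delta & \phi & 1-\delta-\phi\\ 0 & 0 & 1-\kappa & \kappa\end{pmatrix}.$$ Let the eigenvalues of $A$, which are all real, be listed with algebraic multiplicity as $\lambda_1(A)=1\ge\lambda_2(A)\ge\lambda_3(A)\ge\lambda_4(A)$. Then $$\lambda_2(A)\ge 0.$$
   Context: The matrices $A$ of this form are exactly the $4\times4$ tridiagonal (row-)stochastic matrices, i.e. tridiagonal matrices with nonnegative entries and all row sums equal to $1$. No irreducibility is assumed. *)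

(* Defs.v *)
From mathcomp Require Import all_boot all_order all_algebra.
From mathcomp Require Import reals.

Set Implicit Arguments.
Unset Strict Implicit.
Unset Printing Implicit Defensive.

Import Order.TTheory GRing.Theory Num.Theory.

Local Open Scope ring_scope.

Definition tridiag4 (R : realType) (alpha beta gamma delta phi kappa : R) :
    'M[R]_4 :=
  \matrix_(i < 4, j < 4)
    nth 0 (nth [::] [::
        [:: alpha; 1 - alpha; 0; 0];
        [:: beta; gamma; 1 - beta - gamma; 0];
        [:: 0; delta; phi; 1 - delta - phi];
        [:: 0; 0; 1 - kappa; kappa]] i) j.

(* The factorization of the characteristic polynomial counts every eigenvalue
   with its algebraic multiplicity.  For a given A, such an s exists if and only
   if char_poly A splits over R, and it is then unique. *)
Definition eigenvalue_listing (R : realType) (n : nat) (A : 'M[R]_n)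
    (s : n.-tuple R) : Prop :=
  char_poly A = \prod_(x <- s) ('X - x%:P) /\ sorted >=%R s.

(* Main.v *)
(* On consecutive differences x_i - x_(i+1), A acts by a 3x3 tridiagonal matrix
   whose off-diagonal products b, c are nonnegative, and char_poly A is (X - 1)
   times the characteristic polynomial q of that matrix.  Let s <= r be the
   eigenvalues of its leading 2x2 block.  Then q is nonpositive at r and
   nonnegative at s, so q splits with largest root at least r.  If r were
   negative, the block would have negative diagonal and determinant
   (beta - alpha)(delta - beta - gamma) - beta(1 - beta - gamma) > 0, which is
   impossible since beta - alpha <= beta and delta <= 1.  Expanding q around 1
   gives nonnegative coefficients, so no root exceeds 1. *)
Require Import Defs.
From mathcomp Require Import all_boot all_order all_algebra.
From mathcomp Require Import reals.
From mathcomp Require Import ring lra.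

Set Implicit Arguments.
Unset Strict Implicit.
Unset Printing Implicit Defensive.

Import Order.TTheory GRing.Theory Num.Theory.

Local Open Scope ring_scope.

(** Entries are read through [k] on natural numbers so that the lifted ordinals of the cofactor
    expansion simplify by computation. *)
Lemma det_tridiag4 (R : comPzRingType) (M : 'M[R]_4) (k : nat -> nat -> R) :
  (forall i j : 'I_4, M i j = k i j) ->
  k 0 2 = 0 -> k 0 3 = 0 -> k 1 3 = 0 ->
  k 2 0 = 0 -> k 3 0 = 0 -> k 3 1 = 0 ->
  \det M = k 0 0 * (k 1 1 * (k 2 2 * k 3 3 - k 2 3 * k 3 2)
                    - k 1 2 * k 2 1 * k 3 3)
           - k 0 1 * k 1 0 * (k 2 2 * k 3 3 - k 2 3 * k 3 2).
Proof.
move=> Mk k02 k03 k13 k20 k30 k31.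
rewrite (expand_det_row _ ord0) !big_ord_recl big_ord0 /cofactor.
rewrite !(expand_det_row _ ord0) !big_ord_recl !big_ord0 /cofactor.
rewrite !(expand_det_row _ ord0) !big_ord_recl !big_ord0 /cofactor.
rewrite !det_mx11 !mxE !Mk /= /bump /= !(k02, k03, k13, k20, k30, k31).
ring.
Qed.

(** Characteristic polynomial of a tridiagonal 3x3 matrix with diagonal [m1], [m2], [m3], where [b]
    and [c] are the products of opposite off-diagonal entries. *)
Definition jacobi3 (R : comNzRingType) (m1 m2 m3 b c : R) : {poly R} :=
  ('X - m3%:P) * (('X - m1%:P) * ('X - m2%:P) - b%:P)
  - c%:P * ('X - m1%:P).

Lemma horner_jacobi3 (R : comNzRingType) (m1 m2 m3 b c x : R) :
  (jacobi3 m1 m2 m3 b c).[x] =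
  (x - m3) * ((x - m1) * (x - m2) - b) - c * (x - m1).
Proof. by rewrite /jacobi3 !hornerE. Qed.

(** These are the roots of [(X - m1) * (X - m2) - b]; the square root of the discriminant
    [(m1 - m2) ^+ 2 + 4 * b] is at least [|m1 - m2|], hence the interlacing. *)
Lemma real_quadratic_roots (R : rcfType) (m1 m2 b : R) : 0 <= b ->
  exists r s : R, [/\ r + s = m1 + m2, r * s = m1 * m2 - b, s <= m1 <= r
                    & s <= m2 <= r].
Proof.
move=> b_ge0; set D := (m1 - m2) ^+ 2 + 4 * b.
have D_ge0 : 0 <= D by rewrite addr_ge0 ?sqr_ge0 ?mulr_ge0.
have D2 := sqr_sqrtr D_ge0; have d_ge0 := sqrtr_ge0 D.
have [d1 d2]: m1 - m2 <= Num.sqrt D /\ m2 - m1 <= Num.sqrt D.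
  have le_d : `|m1 - m2| <= Num.sqrt D.
    by rewrite -sqrtr_sqr ler_wsqrtr // lerDl mulr_ge0.
  by move: le_d; rewrite ler_norml => /andP[]; lra.
exists ((m1 + m2 + Num.sqrt D) / 2), ((m1 + m2 - Num.sqrt D) / 2).
split; [by lra | by move: D2; rewrite /D; nra | lra | lra].
Qed.

(** The alternatives on [z] express, without square roots, that [z] is at most the larger root of
    [(X - m1) * (X - m2) - b]. *)
Lemma jacobi3_splits (R : rcfType) (m1 m2 m3 b c z : R) :
    0 <= b -> 0 <= c ->
    z <= m1 \/ z <= m2 \/ (z - m1) * (z - m2) <= b ->
  exists t u v : R, z <= t /\
    jacobi3 m1 m2 m3 b c = ('X - t%:P) * ('X - u%:P) * ('X - v%:P).
Proof.
move=> b_ge0 c_ge0 z_le.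
have [r [s [rDs rMs /andP[s_m1 m1_r] /andP[s_m2 m2_r]]]] :=
  real_quadratic_roots m1 m2 b_ge0.
have fact2 x : (x - m1) * (x - m2) - b = (x - r) * (x - s).
  have -> : m2 = r + s - m1 by lra.
  have -> : b = m1 * (r + s - m1) - r * s by rewrite rDs rMs; ring.
  ring.
have z_r : z <= r.
  case: z_le => [|[|]]; [lra | lra | rewrite -subr_le0 fact2 => zz].
  by rewrite leNgt; apply/negP => r_z; nra.
pose q := jacobi3 m1 m2 m3 b c.
have qE x : q.[x] = (x - m3) * ((x - r) * (x - s)) - c * (x - m1).
  by rewrite horner_jacobi3 fact2.
have qr : q.[r] <= 0 by rewrite qE subrr; nra.
have qs : 0 <= q.[s] by rewrite qE subrr; nra.
(* Both [M - r] and [M - m3] are at least [1 + c], so their product exceeds [c], while [M - s] is at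
   least [M - m1]. *)
pose M := `|r| + `|m3| + 1 + c.
have [rM m3M] : r + 1 + c <= M /\ m3 + 1 + c <= M.
  by rewrite /M; have := ler_norm r; have := ler_norm m3;
     have := normr_ge0 r; have := normr_ge0 m3; split; lra.
have qM : 0 <= q.[M].
  have h1 : c <= (M - m3) * (M - r) by nra.
  have h2 : c * (M - m1) <= (M - m3) * (M - r) * (M - s).
    by apply: ler_pM; lra.
  by rewrite qE; lra.
have r_M : r <= M by lra.
have [t /andP[r_t _] /rootP qt] : exists2 t, r <= t <= M & root q t.
  by apply: poly_ivt => //; rewrite qr qM.
(* Sum and product of the two remaining roots: [X^2 - e1 X + e2] is the quotient of [q] by
   [X - t]. *)
pose e1 := m1 + m2 + m3 - t.
pose e2 := m1 * m2 + m1 * m3 + m2 * m3 - b - c - t * e1.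
have quadE x : q.[x] = (x - t) * (x ^+ 2 - e1 * x + e2).
  rewrite -[LHS]subr0 -qt /q !horner_jacobi3 /e2 /e1; ring.
(* A monic quadratic that is nonpositive somewhere has nonnegative discriminant. *)
have disc y : y ^+ 2 - e1 * y + e2 <= 0 -> 0 <= e1 ^+ 2 - 4 * e2.
  by have := sqr_ge0 (2 * y - e1); nra.
have {}disc : 0 <= e1 ^+ 2 - 4 * e2.
  have [s_t|t_s] := ltrP s t.
    by apply: (disc s); move: qs; rewrite quadE; nra.
  (* Here r, s, t, m1, m2 coincide, so the cofactor of X - t is
     (X - m3) * (X - t) - c, nonpositive at t. *)
  have [Em1 Em2] : m1 = t /\ m2 = t by split; lra.
  apply: (disc t); rewrite /e2 /e1 Em1 Em2; nra.
have e_ge0 : 0 <= e1 ^+ 2 / 4 - e2 by lra.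
have [u [v [uDv uMv _ _]]] := real_quadratic_roots (e1 / 2) (e1 / 2) e_ge0.
exists t, u, v; split; first lra.
have {}uDv : u + v = e1 by lra.
have {}uMv : u * v = e2 by rewrite uMv; field.
(* Only the constant coefficient depends on [t] being a root; the others match by the choice of [e1]
   and [e2]. *)
have ct : m1 * m2 * m3 - b * m3 - c * m1 = t * e2.
  move: qt; rewrite /q horner_jacobi3 /e2 /e1 => qt.
  by apply/eqP; rewrite -subr_eq0 -oppr_eq0 -{}[X in _ == X]qt; apply/eqP; ring.
have -> : ('X - t%:P) * ('X - u%:P) * ('X - v%:P) =
  'X^3 - (t + e1)%:P * 'X^2 + (t * e1 + e2)%:P * 'X - (t * e2)%:P.
  by rewrite -uDv -uMv !(polyCD, polyCM); ring.
rewrite -ct /jacobi3 /e2 /e1 !(polyCD, polyCM, polyCN); ring.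
Qed.

(* The cubic factor is the characteristic polynomial of the action of A on the
   consecutive differences x_i - x_(i+1) of a vector x. *)
Lemma char_poly_tridiag4 (R : realType) (alpha beta gamma delta phi kappa : R) :
  char_poly (tridiag4 alpha beta gamma delta phi kappa) =
  ('X - 1%:P) *
  jacobi3 (alpha - beta) (beta + gamma - delta) (kappa - (1 - delta - phi))
    (beta * (1 - beta - gamma)) (delta * (1 - delta - phi)).
Proof.
pose k (i j : nat) : {poly R} := 'X *+ (i == j) -
  (nth 0 (nth [::] [::
        [:: alpha; 1 - alpha; 0; 0];
        [:: beta; gamma; 1 - beta - gamma; 0];
        [:: 0; delta; phi; 1 - delta - phi];
        [:: 0; 0; 1 - kappa; kappa]] i) j)%:P.
rewrite /char_poly (@det_tridiag4 _ _ k); last first.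
- by rewrite /k /= mulr0n subrr.
- by rewrite /k /= mulr0n subrr.
- by rewrite /k /= mulr0n subrr.
- by rewrite /k /= mulr0n subrr.
- by rewrite /k /= mulr0n subrr.
- by rewrite /k /= mulr0n subrr.
- by move=> i j; rewrite !mxE.
rewrite /k /jacobi3 /= !(mulr0n, mulr1n) !(polyCD, polyCM, polyCN); ring.
Qed.

Theorem theorem3p2 (R : realType) (alpha beta gamma delta phi kappa : R)
  (halpha : 0 <= alpha <= 1) (hbeta : 0 <= beta <= 1)
  (hgamma : 0 <= gamma <= 1) (hdelta : 0 <= delta <= 1)
  (hphi : 0 <= phi <= 1) (hkappa : 0 <= kappa <= 1)
  (hbg : beta + gamma <= 1) (hdp : delta + phi <= 1) :
  let A := tridiag4 alpha beta gamma delta phi kappa in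
  (exists lambda : 4.-tuple R, eigenvalue_listing A lambda) /\
  (forall lambda : 4.-tuple R, eigenvalue_listing A lambda ->
     lambda`_0 = 1 /\ 0 <= lambda`_1).
Proof.
move=> A.
case/andP: halpha => a0 a1; case/andP: hbeta => b0 b1.
case/andP: hgamma => g0 g1; case/andP: hdelta => d0 d1.
case/andP: hphi => p0 p1; case/andP: hkappa => k0 k1.
have := char_poly_tridiag4 alpha beta gamma delta phi kappa; rewrite -/A.
set q := jacobi3 _ _ _ _ _ => charA.
have [t [u [v [t_ge0 qE]]]] : exists t u v : R, 0 <= t /\
    q = ('X - t%:P) * ('X - u%:P) * ('X - v%:P).
  apply: jacobi3_splits; [by nra | by nra |].
  have [|m1_lt0] := lerP 0 (alpha - beta); first by left.
  have [|m2_lt0] := lerP 0 (beta + gamma - delta); first by right; left.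
  (* At [z = 0] the remaining alternative says that the leading block has nonpositive
     determinant. *)
  right; right; rewrite !sub0r mulrNN.
  have h1 : (beta - alpha) * (delta - beta - gamma) <=
            beta * (delta - beta - gamma) by apply: ler_wpM2r; lra.
  have h2 : beta * (delta - beta - gamma) <= beta * (1 - beta - gamma).
    by apply: ler_wpM2l; lra.
  lra.
have q_gt0 x : 1 < x -> 0 < q.[x].
  move=> x_gt1; rewrite horner_jacobi3.
  set a := 1 - alpha; set c := 1 - beta - gamma.
  set e := 1 - delta - phi; set f := 1 - kappa; set y := x - 1.
  have [a_ge0 c_ge0 e_ge0 f_ge0] : [/\ 0 <= a, 0 <= c, 0 <= e & 0 <= f].
    by split; rewrite /a /c /e /f; lra.
  have y_gt0 : 0 < y by rewrite /y; lra.
  have -> : (x - (kappa - e)) * ((x - (alpha - beta)) *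
      (x - (beta + gamma - delta)) - beta * c) - delta * e * (x - (alpha - beta))
    = y ^+ 3 + (y ^+ 2 * (a + beta + c + delta + e + f)
      + y * ((a + beta) * (c + delta + e + f) - beta * c
        + c * (e + f) + delta * f)
      + (a * c * (e + f) + (a + beta) * delta * f)).
    by rewrite /a /c /e /f /y; ring.
  (* The only negative term of the expansion in [y] cancels. *)
  have -> : (a + beta) * (c + delta + e + f) - beta * c =
    a * c + (a + beta) * (delta + e + f) by ring.
  have y_ge0 := ltW y_gt0; clearbody a c e f y.
  rewrite ltr_wpDr ?exprn_gt0 //.
  by do !(apply: exprn_ge0 || apply: addr_ge0 || apply: mulr_ge0 || assumption).
split.
  exists (sort_tuple >=%R [tuple 1; t; u; v]); split; last first.
    by apply: sort_sorted => x y; exact: le_total.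
  rewrite (perm_big [:: 1; t; u; v]) /=; last by rewrite perm_sort.
  by rewrite charA qE !big_cons big_nil mulr1 !mulrA.
move=> [[|l0 [|l1 [|l2 [|l3 [|? ?]]]]] //= sz] [].
rewrite !big_cons big_nil mulr1 /= charA => charE /and4P[l10 l21 l32 _].
have evalE x : (x - 1) * q.[x] = (x - l0) * ((x - l1) * ((x - l2) * (x - l3))).
  by have := congr1 (horner^~ x) charE; rewrite !(hornerM, hornerXsubC).
(* Beyond 1 both [X - 1] and [q] are positive; since 1 is itself a listed root, the largest one is
   1. *)
have l0_le1 : l0 <= 1.
  rewrite leNgt; apply/negP => l0_gt1.
  have := evalE l0; rewrite subrr mul0r => /eqP; apply/negP.
  by rewrite mulf_neq0 ?gt_eqF ?q_gt0 // subr_gt0.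
have l0_eq1 : l0 = 1.
  have := evalE 1; rewrite subrr mul0r => /esym/eqP; rewrite !mulf_eq0 !subr_eq0.
  by case/or4P=> /eqP E; apply: le_anti; rewrite l0_le1 /=; lra.
split=> //; rewrite leNgt; apply/negP => l1_lt0.
(* After cancelling [X - 1], the roots of [q] are [l1], [l2], [l3], all negative, yet [t] is a
   nonnegative root. *)
move: charE; rewrite l0_eq1 => /(mulfI (negbT (polyXsubC_eq0 1))) qE'.
have : q.[t] = 0 by rewrite qE !(hornerM, hornerXsubC) subrr !mul0r.
rewrite qE' !(hornerM, hornerXsubC) => /eqP; apply/negP.
by rewrite !mulf_neq0 // gt_eqF // subr_gt0; lra.
Qed.
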